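(* For every integer $n \geq 336$, we have $\hat{m}(n) \leq 4n$.
   Context: For a graph $G$, the Maker-Breaker Hamiltonicity game on $E(G)$ is played as follows: two players, Maker and Breaker, alternately claim previously unclaimed edges of $G$, one edge per move, until all edges are claimed. Maker wins if he claims all edges of some Hamiltonian cycle of $G$; otherwise (i.e. if Breaker claims at least one edge of every Hamiltonian cycle of $G$) Breaker wins. Maker ''can win'' if he has a strategy guaranteeing his win against every play of Breaker; ''Maker as first player'' means that Maker makes the first move. $\hat{m}(n)$ denotes the smallest number of edges of a (finite, simple) graph $G$ on $n$ vertices such that Maker, as first player, can win the Maker-Breaker Hamiltonicity game played on $E(G)$. *)

(* Defs.v *)
From mathcomp Require Import all_boot.

Set Implicit Arguments.
Unset Strict Implicit.
Unset Printing Implicit Defensive.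

Section Game.

Variable V : finType.

(* A simple graph on V is given by its edge set, a set of unordered pairs. *)
Definition edge_set (E : {set {set V}}) : Prop :=
  forall e, e \in E -> #|e| = 2.

Definition cycle_edges (c : seq V) : {set {set V}} :=
  [set [set x; next c x] | x in c].

(* c lists the vertices in cyclic order.  Without 2 < #|V|, the empty         *)
(* sequence, or a single edge traversed twice, would be accepted.             *)
Definition hamiltonian_cycle (E : {set {set V}}) (c : seq V) : Prop :=
  [/\ 2 < #|V|, uniq c, forall x, x \in c & cycle_edges c \subset E].

(* A (partial) play on E is the sequence of edges claimed so far, in order of *)
(* claiming, by Maker at even positions and by Breaker at odd ones.           *)
Definition play (E : {set {set V}}) (s : seq {set V}) : Prop :=
  uniq s /\ {subset s <= E}.

Definition complete_play (E : {set {set V}}) (s : seq {set V}) : Prop :=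
  play E s /\ {subset E <= s}.

Definition maker_edges (s : seq {set V}) : {set {set V}} :=
  [set e in s | ~~ odd (index e s)].

Definition maker_won (E : {set {set V}}) (s : seq {set V}) : Prop :=
  exists2 c, hamiltonian_cycle E c & cycle_edges c \subset maker_edges s.

(* Whenever it is Maker's turn and an edge is left, sigma must name an        *)
(* unclaimed edge of E; its other values are irrelevant.                      *)
Definition maker_strategy (E : {set {set V}})
    (sigma : seq {set V} -> {set V}) : Prop :=
  forall s, play E s -> ~~ odd (size s) -> size s < #|E| ->
    sigma s \in E /\ sigma s \notin s.

Definition follows (sigma : seq {set V} -> {set V}) (s : seq {set V}) : Prop :=
  forall i, i < size s -> ~~ odd i -> nth set0 s i = sigma (take i s).

Definition maker_can_win_first (E : {set {set V}}) : Prop :=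
  exists2 sigma, maker_strategy E sigma &
    forall s, complete_play E s -> follows sigma s -> maker_won E s.

End Game.

(* m is the smallest number of edges of a graph on n vertices on which Maker, *)
(* as first player, can win; a relation, since for small n there may be no    *)
(* such graph.                                                                *)
Definition is_mhat (n m : nat) : Prop :=
  (exists E : {set {set 'I_n}},
     [/\ edge_set E, maker_can_win_first E & #|E| = m]) /\
  (forall E : {set {set 'I_n}},
     edge_set E -> maker_can_win_first E -> m <= #|E|).

(* Main.v *)
Require Import Defs.
From mathcomp Require Import all_boot zify.
From Stdlib Require Import BinNat ClassicalEpsilon.

(* Call a graph on x_0, ..., x_d without the edge x_0 x_d a link if Maker,     *)
(* playing second, can claim a Hamiltonian path from x_0 to x_d.              *)
(* - K_8 minus an edge is a link with d = 7 and 27 edges.  This is a finite   *)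
(*   game, settled by a certificate: a list of positions up to relabelling,   *)
(*   each with enough replies of Maker that every edge of Breaker is avoided  *)
(*   by one of them together with the board on which Maker then goes on.      *)
(* - Two links can be glued at an end.  They can also be joined by 18 edges   *)
(*   through one more vertex w and two new ends: Maker wins the bridging game *)
(*   on the 7 vertices that remain when each link is contracted to an edge    *)
(*   that must be used.  Two K_8 links give d = 18 and 72 = 4 * 18 edges.     *)
(* - Two links with the same two ends form a graph on d + d' vertices in      *)
(*   which Maker gets a Hamiltonian cycle, since he can play on both boards   *)
(*   separately.  Every n >= 336 is of the form 7 * a + 18 * b with a >= 2.   *)

Set Implicit Arguments.
Unset Strict Implicit.
Unset Printing Implicit Defensive.

(** The budget is four edges per unit of length, the length d of a link being the number of edges of
    its Hamiltonian path. Two links with the same ends and lengths d, d' close up to a graph on d +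
    d' vertices, so it suffices to build links within budget of enough lengths. K_8 minus an edge
    costs 27, one less than 4 * 7. Bridging adds 4 to the length, which pays for 16 edges, but uses
    18; the two extra edges are those saved by the two K_8 links. Gluing preserves the budget, and 7
    and 18 being coprime, all large lengths occur.

    Everything rests on composing games: a Maker who plays second answers on the board where Breaker
    moved, so he wins on edge-disjoint boards at once ([mwin_and]). This gives [link_series],
    [link_bridge] and [links_can_win_first]. The two finite games, [K8_win] and [bridge_win], are
    settled by computations proved sound. [mwin_can_win_first] turns the inductive notion of winning
    into a strategy for Maker as first player. *)

(** * Games with Maker as second player, and their composition *)

Definition monotone (T : eqType) (P : seq T -> Prop) : Prop :=
  forall M M' : seq T, {subset M <= M'} -> P M -> P M'.

(* Maker owns M and plays second on the free board C.  Breaker's move ranges  *)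
(* over all of T: a move outside C is a pass on C, which is what makes        *)
(* positions on disjoint boards compose.                                      *)
Inductive mwin (T : eqType) (P : seq T -> Prop) (M C : seq T) : Prop :=
| Mwon of P M
| Mmove of forall e, exists f,
    [/\ f \in C, f != e & mwin P (f :: M) [seq g <- C | g \notin [:: e; f]]].

Section Positions.

Variables (T : eqType) (P : seq T -> Prop).

(** The recursive occurrence in [mwin] lies under [exists] and a conjunction, where the generated
    principle gives no induction hypothesis; an explicit fixpoint supplies it. *)
Lemma mwin_nested_ind (Q : seq T -> seq T -> Prop) :
    (forall M C, P M -> Q M C) ->
    (forall M C,
      (forall e, exists f, [/\ f \in C, f != e,
         mwin P (f :: M) [seq g <- C | g \notin [:: e; f]] &
         Q (f :: M) [seq g <- C | g \notin [:: e; f]]]) -> Q M C) ->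
  forall M C, mwin P M C -> Q M C.
Proof.
move=> Qwon Qmove; fix F 3 => M C [wM|mM]; first exact: Qwon.
apply: Qmove => e; case: (mM e) => f [Cf fe w].
by exists f; split=> //; apply: F.
Qed.

Hypothesis P_mono : monotone P.

Lemma mwin_sub M C M' C' :
  mwin P M C -> {subset M <= M'} -> {subset C <= C'} -> mwin P M' C'.
Proof.
move=> w; elim/mwin_nested_ind: w M' C' => {M C} [M C wM|M C IH] M' C' sM sC.
  by left; apply: P_mono wM.
right=> e; have [f [Cf fe _ IHf]] := IH e; exists f; split=> //; first exact: sC.
apply: IHf => [g|g]; first by rewrite !inE => /orP[->//|/sM->]; rewrite orbT.
by rewrite !mem_filter => /andP[-> /sC].
Qed.

(** Finite games are certified in this form: the boards [k.1 :: k.2] have no common element, so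
    after any move of Breaker one of them is still entirely free, and Maker moves there. *)
Lemma mwin_responses M C (ks : seq (T * seq T)) :
    (forall e, exists2 k, k \in ks & e \notin k.1 :: k.2) ->
    (forall k, k \in ks ->
       [/\ k.1 \notin k.2, mwin P (k.1 :: M) k.2 & {subset k.1 :: k.2 <= C}]) ->
  mwin P M C.
Proof.
move=> miss good; right=> e; have [k ks_k ek] := miss e.
have [kk wk sk] := good k ks_k; exists k.1; split.
- by apply: sk; rewrite mem_head.
- by apply: contraNneq ek => <-; rewrite mem_head.
- apply: mwin_sub wk _ _ => // g gk; rewrite mem_filter !inE negb_or sk ?inE ?gk ?orbT //.
  rewrite andbT; apply/andP; split; last by apply: contraNneq kk => <-.
  by apply: contraNneq ek => <-; rewrite inE gk orbT.
Qed.

End Positions.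

Lemma mwin_impl (T : eqType) (P Q : seq T -> Prop) M C :
  (forall M', P M' -> Q M') -> mwin P M C -> mwin Q M C.
Proof.
move=> PQ; elim/mwin_nested_ind => {M C} [M C /PQ|M C IH]; first by left.
by right=> e; have [f [Cf fe _ w]] := IH e; exists f.
Qed.

Lemma mwin_map (T T' : eqType) (x0 : T) (h : T -> T')
    (P : seq T -> Prop) (Q : seq T' -> Prop) M C :
    monotone Q -> (forall M', P M' -> Q (map h M')) -> {in C &, injective h} ->
  mwin P M C -> mwin Q (map h M) (map h C).
Proof.
move=> Qm PQ hI w; elim/mwin_nested_ind: w hI => {M C} [M C /PQ|M C IH] hI.
  by left.
right=> e'; have [[e ehe]|ne] : (exists e, [/\ e \in C & e' = h e]) \/ e' \notin map h C.
- by case: (boolP (e' \in _)) => [/mapP[e Ce ->]|]; [left; exists e|right].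
- case: ehe => Ce ->; have [f [Cf fe _ w]] := IH e; exists (h f); split.
  + exact: map_f.
  + by rewrite (inj_in_eq hI).
  have {}w := w _; apply: (mwin_sub Qm (w _)) => //.
    by move=> a b; rewrite !mem_filter => /andP[_ Ca] /andP[_ Cb]; apply: hI.
  move=> _ /mapP[a +->]; rewrite !mem_filter !inE => /andP[+ Ca].
  by rewrite !(inj_in_eq hI) ?map_f //= => ->.
(* A move off the image is a pass, so Maker may answer as he would answer the arbitrary [x0]. *)
- have [f [Cf fe _ w]] := IH x0; exists (h f); split; first exact: map_f.
    by apply: contraNneq ne => <-; apply: map_f.
  apply: (mwin_sub Qm (w _)) => //.
    by move=> a b; rewrite !mem_filter => /andP[_ Ca] /andP[_ Cb]; apply: hI.
  move=> _ /mapP[a +->]; rewrite !mem_filter !inE !negb_or => /andP[/andP[_ af] Ca].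
  rewrite (inj_in_eq hI) ?map_f // af !andbT.
  by apply: contraNneq ne => <-; apply: map_f.
Qed.

Lemma mwin_conj_won (T : eqType) (P Q : seq T -> Prop) M C :
  monotone P -> P M -> mwin Q M C -> mwin (fun N => P N /\ Q N) M C.
Proof.
move=> Pm + w; elim/mwin_nested_ind: w => {M C} [M C wM|M C IH] PM; first by left.
right=> e; have [f [Cf fe _ w]] := IH e; exists f; split=> //; apply: w.
by apply: Pm PM => g Mg; rewrite inE Mg orbT.
Qed.

(* Maker answers on the board on which Breaker has just moved. *)
Lemma mwin_and (T : eqType) (P Q : seq T -> Prop) M C M' C' M0 C0 :
    monotone P -> monotone Q ->
    mwin P M C -> mwin Q M' C' -> {in C, forall e, e \notin C'} ->
    {subset M <= M0} -> {subset M' <= M0} ->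
    {subset C <= C0} -> {subset C' <= C0} ->
  mwin (fun N => P N /\ Q N) M0 C0.
Proof.
move=> Pm Qm w w'.
elim/mwin_nested_ind: w M' C' w' M0 C0 => {M C} [M C wM|M C IH] M' C' w' M0 C0.
  move=> _ sM sM' _ sC'; apply: mwin_conj_won; [done | exact: Pm wM |].
  exact: mwin_sub w' _ _.
elim/mwin_nested_ind: w' M0 C0 => {M' C'} [M' C' wM'|M' C' IH'] M0 C0 dC sM sM' sC sC'.
  apply: (mwin_impl (P := fun N => Q N /\ P N)); first by move=> ? [].
  apply: mwin_conj_won; [done | exact: Qm wM' |].
  apply: (mwin_sub Pm _ sM sC); right=> e.
  by have [f [Cf fe w _]] := IH e; exists f.
have sub_cons (N N' : seq T) f : {subset N <= N'} -> {subset f :: N <= f :: N'}.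
  by move=> sN g; rewrite !inE => /orP[->//|/sN->]; rewrite orbT.
have sub_behead (N N' : seq T) f : {subset N <= N'} -> {subset N <= f :: N'}.
  by move=> sN g /sN Ng; rewrite inE Ng orbT.
have sub_del (N N' : seq T) e f : {subset N <= N'} ->
    {subset [seq g <- N | g \notin [:: e; f]] <= [seq g <- N' | g \notin [:: e; f]]}.
  by move=> sN g; rewrite !mem_filter => /andP[-> /sN].
have sub_keep (N N' : seq T) e f : {subset N <= N'} -> e \notin N -> f \notin N ->
    {subset N <= [seq g <- N' | g \notin [:: e; f]]}.
  move=> sN Ne Nf g Ng; rewrite mem_filter sN // andbT !inE negb_or.
  by apply/andP; split; [apply: contraNneq Ne | apply: contraNneq Nf] => <-.
(* A move on [C'] is answered there, by the inner induction. Any other move, even one off both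
   boards, is answered on [C], by the outer induction, with the second game left as it was. *)
right=> e; case: (boolP (e \in C')) => C'e.
  have Ce : e \notin C by apply: contraTN C'e => /dC.
  have [f [C'f fe w' IHf]] := IH' e; exists f; split; rewrite ?sC' //.
  have Cf : f \notin C by apply: contraTN C'f => /dC.
  apply: IHf; [ | exact: sub_behead | exact: sub_cons | exact: sub_keep | exact: sub_del].
  by move=> g Cg; rewrite mem_filter negb_and dC ?orbT.
have [f [Cf fe w IHf]] := IH e; exists f; split; rewrite ?sC //.
apply: (IHf M' C').
- by right=> e'; have [f' [C'f' f'e' w' _]] := IH' e'; exists f'.
- by move=> g; rewrite mem_filter => /andP[_ /dC].
- exact: sub_cons.
- exact: sub_behead.
- exact: sub_del.
- by apply: (sub_keep _ _ _ _ sC' C'e); apply: dC.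
Qed.

(** * From inductive wins to strategies for the first player *)

Section Strategy.

Variables (V : finType) (E : {set {set V}}) (P : seq {set V} -> Prop).
Hypothesis P_mono : monotone P.

Definition claimed (s : seq {set V}) : seq {set V} :=
  [seq e <- s | ~~ odd (index e s)].

Definition unclaimed (s : seq {set V}) : seq {set V} :=
  [seq e <- enum E | e \notin s].

Definition good_reply (s : seq {set V}) (f : {set V}) : Prop :=
  f \in unclaimed s /\ mwin P (f :: claimed s) (unclaimed (rcons s f)).

(** Choice makes the replies promised by [mwin] a function of the history. The default keeps the
    strategy legal where no good reply need exist, for instance once Maker has won. *)
Definition winning_strategy (s : seq {set V}) : {set V} :=
  if excluded_middle_informative (exists f, good_reply s f) is left ex
  then proj1_sig (constructive_indefinite_description _ ex)
  else head set0 (unclaimed s).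

Lemma mem_unclaimed s e : (e \in unclaimed s) = (e \in E) && (e \notin s).
Proof. by rewrite mem_filter mem_enum andbC. Qed.

Lemma winning_strategy_unclaimed s :
  (exists e, e \in unclaimed s) -> winning_strategy s \in unclaimed s.
Proof.
move=> [e ue]; rewrite /winning_strategy.
case: excluded_middle_informative => [ex|_].
  by case: constructive_indefinite_description => f [].
by case: (unclaimed s) ue => //= f u _; rewrite mem_head.
Qed.

Lemma claimed_rcons s e : e \notin s ->
  claimed (rcons s e) = if odd (size s) then claimed s else rcons (claimed s) e.
Proof.
move=> se; rewrite /claimed filter_rcons.
have -> : index e (rcons s e) = size s.
  by rewrite -cats1 index_cat (negPf se) /= eqxx addn0.
have -> : [seq g <- s | ~~ odd (index g (rcons s e))] = [seq g <- s | ~~ odd (index g s)].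
  by apply: eq_in_filter => g sg; rewrite -cats1 index_cat sg.
by case: (odd _).
Qed.

Lemma winning_invariant s : mwin P [::] (enum E) ->
    play E s -> follows winning_strategy s ->
  if odd (size s) then mwin P (claimed s) (unclaimed s)
  else P (claimed s) \/ exists f, good_reply s f.
Proof.
move=> w0; elim/last_ind: s => [|s e IH].
  move=> _ _ /=; case: w0 => [|w0]; [by left | right].
  (* Maker opens with his reply to an imaginary first move [set0] of Breaker. *)
  have [f [Ef _ w]] := w0 set0; exists f; split.
    by rewrite mem_unclaimed -mem_enum Ef.
  apply: (mwin_sub P_mono w) => // g; rewrite mem_filter mem_unclaimed mem_enum !inE.
  by rewrite negb_or => /andP[/andP[_ ->] ->].
move=> [us sE] fs; rewrite size_rcons /=.
have [se us'] : e \notin s /\ uniq s by move: us; rewrite rcons_uniq => /andP.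
have Ee : e \in E by apply: sE; rewrite mem_rcons mem_head.
have {}IH : if odd (size s) then mwin P (claimed s) (unclaimed s)
            else P (claimed s) \/ exists f, good_reply s f.
  apply: IH; first by split=> // g sg; apply: sE; rewrite mem_rcons inE sg orbT.
  move=> i si ei; have := fs i; rewrite size_rcons nth_rcons si leqW // => ->//.
  by rewrite -cats1 takel_cat // ltnW.
rewrite (claimed_rcons se); case: (boolP (odd (size s))) IH => /= os.
  case=> [|w]; [by left | right].
  have [f [uf fe w']] := w e; exists f; split.
    by move: uf; rewrite !mem_unclaimed mem_rcons inE negb_or fe.
  rewrite claimed_rcons // os; apply: (mwin_sub P_mono w') => // g.
  rewrite mem_filter !mem_unclaimed !(mem_rcons, inE) !negb_or.
  by move=> /andP[/andP[-> ->] /andP[-> ->]].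
have ->: e = winning_strategy s.
  have := fs (size s); rewrite size_rcons nth_rcons ltnn eqxx -cats1 take_size_cat //.
  by rewrite ltnSn os => ->.
case=> [won|ex]; first by left; apply: P_mono won => g; rewrite mem_rcons inE => ->; rewrite orbT.
rewrite /winning_strategy; case: excluded_middle_informative => // ex'.
case: constructive_indefinite_description => f [uf w] /=.
by apply: mwin_sub w _ _ => // g; rewrite mem_rcons.
Qed.

Lemma mwin_can_win_first :
    mwin P [::] (enum E) ->
    (forall M, {subset M <= E} -> P M ->
       exists2 c, hamiltonian_cycle E c & {subset cycle_edges c <= M}) ->
  maker_can_win_first E.
Proof.
move=> w0 PH; exists winning_strategy.
  move=> s [us sE] _ sz; apply/andP; rewrite -mem_unclaimed.
  apply: winning_strategy_unclaimed; apply/existsP; apply: contraLR sz.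
  rewrite negb_exists -leqNgt => /forallP no; rewrite cardE uniq_leq_size ?enum_uniq // => e.
  by rewrite mem_enum => Ee; have := no e; rewrite mem_unclaimed Ee /= negbK.
move=> s [[us sE] Es] fs; have u0 e : e \in unclaimed s = false.
  by rewrite mem_unclaimed; case: (boolP (e \in E)) => //= /Es ->.
have cE : {subset claimed s <= E} by move=> e; rewrite mem_filter => /andP[_ /sE].
have /(PH _ cE)[c cH sc] : P (claimed s).
  (* When the play is complete no edge is left for a reply, so only the alternatives in which Maker
     has won survive. *)
  have := winning_invariant w0 (conj us sE) fs; case: odd.
    by case=> // w; have [f []] := w set0; rewrite u0.
  by case=> // -[f []]; rewrite u0.
exists c => //; apply/subsetP => e /sc; rewrite mem_filter !inE.
by rewrite andbC.
Qed.

End Strategy.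

(** * A sound solver for finite games *)

Lemma mwin_cat (T : eqType) (P Q : seq T -> Prop) L M C :
    monotone P -> (forall N, Q N -> P (L ++ N)) ->
  mwin Q M C -> mwin P (L ++ M) C.
Proof.
move=> Pm QP; elim/mwin_nested_ind => {M C} [M C /QP|M C IH]; first by left.
right=> e; have [f [Cf fe _ w]] := IH e; exists f; split=> //.
by apply: mwin_sub w _ _ => // g; rewrite !(inE, mem_cat) orbCA.
Qed.

(* Edges of the complete graph on the labels 0, 1, ..., smaller end first. *)
Notation code := (nat * nat)%type.

(* The conditionals below keep call-by-value evaluation from exploring both   *)
(* sides of a boolean connective.                                             *)
Fixpoint eq_nat (m n : nat) : bool :=
  match m, n with 0, 0 => true | m'.+1, n'.+1 => eq_nat m' n' | _, _ => false end.

Definition eq_code (e f : code) : bool :=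
  if eq_nat e.1 f.1 then eq_nat e.2 f.2 else false.

Fixpoint in_code (e : code) (s : seq code) : bool :=
  if s is f :: s' then if eq_code e f then true else in_code e s' else false.

Lemma eq_codeE (e f : code) : eq_code e f = (e == f).
Proof.
have eq_natE m n : eq_nat m n = (m == n) by elim: m n => [|m IH] [|n] //=; rewrite IH.
by case: e f => [e1 e2] [f1 f2]; rewrite /eq_code !eq_natE /= xpair_eqE; case: (e1 == f1).
Qed.

Lemma in_codeE e s : in_code e s = (e \in s).
Proof. by elim: s => //= f s ->; rewrite inE eq_codeE; case: (e == f). Qed.

Fixpoint bump (k : N) (e : code) (t : seq (N * code)) : seq (N * code) :=
  if t is p :: t' then
    if eq_code e p.2 then ((p.1 + k)%num, p.2) :: t' else p :: bump k e t'
  else [:: (k, e)].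

(** An edge weighs the sum of 4 ^ (n - |w|) over the sets w containing it, a potential of
    Erdős-Selfridge type that favours nearly completed sets. Soundness depends only on which edges
    are listed, not on their order. *)
Definition ranking (n : nat) (W : seq (seq code)) : seq code :=
  [seq p.2 | p <- sort (fun p q => (q.1 <=? p.1)%num)
    (foldr (fun w t => foldr (bump (4 ^ N.of_nat (n - size w))) t w) [::] W)].

Fixpoint first_some (A B : Type) (h : A -> option B) (s : seq A) : option B :=
  if s is x :: s' then if h x is Some y then Some y else first_some h s' else None.

(** A new reply is sought only for a move that lies on every board collected so far. *)
Fixpoint refute (respond : code -> option (code * seq code)) (R : seq code)
    (ks : seq (code * seq code)) : option (seq (code * seq code)) :=
  if R is e :: R' then
    if all (fun k => in_code e (k.1 :: k.2)) ks then
      if respond e is Some k then refute respond R' (k :: ks) else None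
    else refute respond R' ks
  else Some ks.

Definition carrier (ks : seq (code * seq code)) : seq code :=
  foldr (fun k s => foldr (fun e s => if in_code e s then s else e :: s) s (k.1 :: k.2))
    [::] ks.

Arguments carrier ks : simpl never.

(* Each reply (f, c) comes with the board c that Maker needs afterwards, so   *)
(* a move of Breaker outside f :: c needs no other reply.  Only the 4 edges   *)
(* of largest weight are tried as replies.                                    *)
Fixpoint solve (n : nat) (W : seq (seq code)) : option (seq code) :=
  let W := [seq w <- W | size w <= n] in
  if has (@nilp code) W then Some [::] else
  if n is n'.+1 then
    let respond e :=
      let U := [seq w <- W | ~~ in_code e w] in
      first_some
        (fun f => if solve n' [seq [seq g <- w | ~~ eq_code f g] | w <- U] is Some c
                  then Some (f, c) else None)
        (take 4 (ranking n U)) in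
    if refute respond (ranking n W) [::] is Some (k :: ks) then Some (carrier (k :: ks))
    else None
  else None.

Definition claims_one (W : seq (seq code)) (M : seq code) : Prop :=
  exists2 w, w \in W & {subset w <= M}.

Lemma claims_one_monotone W : monotone (claims_one W).
Proof. by move=> M M' sM [w Ww sw]; exists w => // e /sw/sM. Qed.

Lemma mem_ranking n W e : (e \in ranking n W) = (e \in flatten W).
Proof.
have mem_bump k f t : (e \in [seq p.2 | p <- bump k f t]) = (e \in f :: [seq p.2 | p <- t]).
  elim: t => //= p t IH; rewrite eq_codeE; case: eqP => [->|_] /=.
    by rewrite !inE; case: eqP.
  by rewrite inE IH !inE orbCA.
rewrite /ranking (perm_mem (perm_map _ (permEl (perm_sort _ _)))).
elim: W => //= w W IH; rewrite mem_cat -IH; move: (4 ^ _)%num => k.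
by elim: w => //= f w IHw; rewrite mem_bump !inE IHw orbA.
Qed.

Lemma mem_carrier ks e : (e \in carrier ks) = has (fun k => e \in k.1 :: k.2) ks.
Proof.
have mem_add s t : (e \in foldr (fun f t => if in_code f t then t else f :: t) t s) =
    (e \in s) || (e \in t).
  elim: s => //= f s IH; rewrite in_codeE inE -orbA -IH.
  by case: ifP => [|_]; rewrite ?inE //; case: eqP => // ->.
by elim: ks => // k ks IH; rewrite [LHS](mem_add (k.1 :: k.2)) IH.
Qed.

Lemma first_someP (A : eqType) B (h : A -> option B) s y :
  first_some h s = Some y -> exists2 x, x \in s & h x = Some y.
Proof.
elim: s => //= x s IH; case hx: (h x) => [z|]; last first.
  by case/IH => x' sx' hx'; exists x'; rewrite // inE sx' orbT.
by move=> -[<-]; exists x; rewrite // mem_head.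
Qed.

Lemma refuteP respond R ks ks' : refute respond R ks = Some ks' ->
    (forall e k, respond e = Some k -> e \notin k.1 :: k.2) ->
  [/\ {subset ks <= ks'},
      {in ks', forall k, k \in ks \/ exists e, respond e = Some k} &
      {in R, forall e, exists2 k, k \in ks' & e \notin k.1 :: k.2}].
Proof.
move=> + miss; elim: R ks => [|e R IH] ks /=.
  by case=> <-; split=> // k; left.
case: ifP => [_|/allPn[k ks_k]]; last first.
  rewrite in_codeE => ek /IH[s1 s2 s3]; split=> // f; rewrite inE => /predU1P[->|/s3//].
  by exists k => //; apply: s1.
case re: (respond e) => [k|//] /IH[s1 s2 s3]; split.
- by move=> k' ks_k'; apply: s1; rewrite inE ks_k' orbT.
- move=> k' /s2[|]; last by right.
  by rewrite inE => /predU1P[->|]; [right; exists e | left].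
- move=> f; rewrite inE => /predU1P[->|/s3//].
  by exists k; [apply: s1; rewrite mem_head | apply: miss re].
Qed.

(** [W] holds what Maker still misses of each winning set, and n bounds his remaining moves. The
    inclusion in [flatten W] carries the induction: replies to e come from sets avoiding e, and
    later boards from sets with f deleted, so e and f cannot recur. *)
Lemma solve_sound n W c : solve n W = Some c ->
  mwin (claims_one W) [::] c /\ {subset c <= flatten W}.
Proof.
elim: n W c => [|n IH] W c /=.
  case: ifP => // /hasP[w + /nilP w0 [<-]]; rewrite mem_filter => /andP[_ Ww].
  by split=> //; left; exists w; last rewrite w0.
set W1 := filter _ W; have sW1 : {subset flatten W1 <= flatten W}.
  by move=> e /flattenP[w +ew]; rewrite mem_filter => /andP[_ Ww]; apply/flattenP; exists w.
case: ifP => [/hasP[w + /nilP w0] [<-]|_].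
  by rewrite mem_filter => /andP[_ Ww]; split=> //; left; exists w; last rewrite w0.
set respond := (X in refute X _ _).
have respondP e k : respond e = Some k ->
    [/\ k.1 \notin k.2, mwin (claims_one W) [:: k.1] k.2,
        {subset k.1 :: k.2 <= flatten W1} & e \notin k.1 :: k.2].
  move=> resp; have [f] := @first_someP code _ _ _ _ resp.
  set U := filter _ W1; set Uf := map _ U => /mem_take; rewrite mem_ranking => Uf_f.
  case sU: (solve n Uf) => [c'|//] [<-] /=; have [w sc'] := IH _ _ sU.
  have cU g : g \in c' -> (f != g) && (g \in flatten U).
    move=> /sc' /flattenP[_ /mapP[u Uu ->]]; rewrite mem_filter eq_codeE => /andP[-> ug].
    by apply/flattenP; exists u.
  have sU1 : {subset f :: c' <= flatten U}.
    by move=> g; rewrite inE => /predU1P[->//|/cU/andP[]].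
  split.
  - by apply/negP => /cU; rewrite eqxx.
  - apply: (mwin_cat (L := [:: f]) (@claims_one_monotone W) _ w) => N [_ /mapP[u Uu ->] uN].
    exists u; first by move: Uu; rewrite !mem_filter => /andP[_ /andP[]].
    move=> g ug; rewrite mem_cat inE; case: eqP => //= /eqP gf; apply: uN.
    by rewrite mem_filter eq_codeE eq_sym gf.
  - move=> g /sU1/flattenP[u Uu ug]; apply/flattenP; exists u => //.
    by move: Uu; rewrite mem_filter => /andP[].
  - apply/negP => /sU1/flattenP[u]; rewrite mem_filter in_codeE => /andP[/negP + _].
    by apply.
case rf: refute => [[|k ks]|] // [<-].
have [_ ks_resp ks_miss] := refuteP rf (fun e k h => let: And4 _ _ _ m := respondP e k h in m).
have ksP k' : k' \in k :: ks -> exists e, respond e = Some k' by case/ks_resp.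
have sc : {subset carrier (k :: ks) <= flatten W1}.
  move=> e; rewrite mem_carrier => /hasP[k' /ksP[e' /respondP[_ _ s _]]]; exact: s.
split; last by move=> e /sc/sW1.
apply: (mwin_responses (@claims_one_monotone W) (ks := k :: ks)).
  move=> e; case: (boolP (e \in ranking n.+1 W1)) => [|re]; first exact: ks_miss.
  exists k; first by rewrite mem_head.
  have [e' /respondP[_ _ s _]] := ksP k (mem_head _ _).
  by apply: contra re => /s; rewrite mem_ranking.
move=> k' kk'; have [e' /respondP[k1 w _ _]] := ksP k' kk'; split=> // g gk.
by rewrite mem_carrier; apply/hasP; exists k'.
Qed.

(** * Routes through prescribed subpaths *)

Definition edge (a b : nat) : code := (minn a b, maxn a b).

Definition is_edge (n : nat) (e : code) : bool := e.1 < e.2 < n.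

Lemma edgeC a b : edge a b = edge b a.
Proof. by rewrite /edge minnC maxnC. Qed.

(* An item (a, b) stands for a path with ends a and b that a route traverses  *)
(* as a whole, in either direction.                                           *)
Definition swap (i : nat * nat) : nat * nat := (i.2, i.1).

Fixpoint insertions (A : Type) (x : A) (s : seq A) : seq (seq A) :=
  (x :: s) :: if s is y :: s' then [seq y :: t | t <- insertions x s'] else [::].

Fixpoint routes (its : seq (nat * nat)) : seq (seq (nat * nat)) :=
  if its is i :: its' then
    [seq t | r <- routes its', t <- flatten [seq insertions j r | j <- undup [:: i; swap i]]]
  else [:: [::]].

(** Only the edges between consecutive items are listed; the path inside an item is claimed on
    another board. *)
Fixpoint trail (u : nat) (r : seq (nat * nat)) (v : nat) : seq code :=
  if r is i :: r' then edge u i.1 :: trail i.2 r' v else [:: edge u v].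

Lemma perm_insertions (T : eqType) (x : T) s t : t \in insertions x s -> perm_eq t (x :: s).
Proof.
elim: s t => [|y s IH] t /=; first by rewrite inE => /eqP->.
rewrite inE => /predU1P[->//|/mapP[t' /IH t's ->]].
by rewrite perm_sym (perm_catCA [:: x] [:: y] s) /= perm_cons perm_sym.
Qed.

Lemma routesP i its t : t \in routes (i :: its) ->
  exists r j, [/\ r \in routes its, j = i \/ j = swap i & perm_eq t (j :: r)].
Proof.
case/allpairsPdep => r [t' [rr /flattenP[_ /mapP[j + ->]] /perm_insertions tj ->]].
rewrite mem_undup !inE => /orP[] /eqP ji; exists r, j; split=> //; [by left | by right].
Qed.

Lemma routes_perm (V : eqType) (ex : nat * nat -> seq V) its r :
    {in its, forall i, perm_eq (ex (swap i)) (ex i)} ->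
  r \in routes its -> perm_eq (flatten (map ex r)) (flatten (map ex its)).
Proof.
elim: its r => [|i its IH] t exE; first by rewrite inE => /eqP->.
case/routesP => r [j [rr ji tj]].
rewrite (permPl (perm_flatten (perm_map ex tj))) /= perm_cat //; last first.
  by apply: IH rr => k its_k; apply: exE; rewrite inE its_k orbT.
by case: ji => ->//; apply: exE; rewrite mem_head.
Qed.

Lemma mem_routes its r i : r \in routes its -> i \in r -> i \in its \/ swap i \in its.
Proof.
elim: its r => [|k its IH] t; first by rewrite inE => /eqP->.
case/routesP => r [j [rr jk tj]]; rewrite (perm_mem tj) inE => /predU1P[->|/(IH _ rr)].
  by case: jk => ->; [left | right; rewrite /swap -surjective_pairing]; rewrite mem_head.
by case=> ii; [left | right]; rewrite inE ii orbT.
Qed.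

(** [ex] replaces each item by an actual path between its ends. Items are single vertices in K_8,
    and also whole links in the bridging game. *)
Lemma trail_path (V : eqType) (adj : rel V) (lab : nat -> V) (ex : nat * nat -> seq V) u r v :
    {in r, forall i, exists t, [/\ ex i = lab i.1 :: t, path adj (lab i.1) t &
                                   last (lab i.1) t = lab i.2]} ->
    (forall a b, edge a b \in trail u r v -> adj (lab a) (lab b)) ->
  path adj (lab u) (rcons (flatten (map ex r)) (lab v)).
Proof.
elim: r u => [|i r IH] u exE adjE /=; first by rewrite adjE ?mem_head.
have [t [-> pt lt]] := exE i (mem_head _ _).
rewrite -cats1 -catA cats1 /= adjE ?mem_head // cat_path pt lt; apply: IH.
  by move=> k rk; apply: exE; rewrite inE rk orbT.
by move=> a b ab; apply: adjE; rewrite inE ab orbT.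
Qed.

(** * Hamiltonian paths of K_8 and their symmetries *)

Definition hampath (M : seq code) : Prop :=
  exists2 s, perm_eq s (iota 1 6) & path (fun a b => edge a b \in M) 0 (rcons s 7).

Lemma hampath_monotone : monotone hampath.
Proof.
move=> M M' sM [s s6 ps]; exists s => //.
by apply: sub_path ps => a b; apply: sM.
Qed.

Definition relabel (p : seq nat) (e : code) : code := edge (nth 0 p e.1) (nth 0 p e.2).

(** The ends may be exchanged, because a Hamiltonian path can be read backwards. *)
Definition relabelling (p : seq nat) : bool :=
  perm_eq p (iota 0 8) && ((nth 0 p 0, nth 0 p 7) \in [:: (0, 7); (7, 0)]).

Lemma relabel_edge p a b : relabel p (edge a b) = edge (nth 0 p a) (nth 0 p b).
Proof. by rewrite /relabel [edge a b]/edge /=; case: (leqP a b) => // _; apply: edgeC. Qed.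

Lemma relabel_is_edge p e : relabelling p -> is_edge 8 e -> is_edge 8 (relabel p e).
Proof.
case/andP => pp _ /andP[e12 e2].
have sp : size p = 8 by rewrite (perm_size pp).
have up : uniq p by rewrite (perm_uniq pp) iota_uniq.
have bnd i : i < 8 -> nth 0 p i < 8.
  by rewrite -{1}sp => /(mem_nth 0); rewrite (perm_mem pp) mem_iota.
have : nth 0 p e.1 != nth 0 p e.2.
  by rewrite nth_uniq ?sp // ?(ltn_trans e12) // neq_ltn e12.
have := bnd e.1 (ltn_trans e12 e2); have := bnd e.2 e2.
rewrite /is_edge /relabel /edge /=; lia.
Qed.

Lemma relabel_inj p : relabelling p -> {in is_edge 8 &, injective (relabel p)}.
Proof.
case/andP => pp _.
have sp : size p = 8 by rewrite (perm_size pp).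
have up : uniq p by rewrite (perm_uniq pp) iota_uniq.
have pI i j : i < 8 -> j < 8 -> nth 0 p i = nth 0 p j -> i = j.
  by move=> i8 j8 /eqP; rewrite nth_uniq ?sp // => /eqP.
have edge_eq m n m' n' : edge m n = edge m' n' -> m = m' /\ n = n' \/ m = n' /\ n = m'.
  by case; lia.
move=> [a b] [c d] /andP[/= ab b8] /andP[/= cd d8] /edge_eq /=.
have [a8 c8] := (ltn_trans ab b8, ltn_trans cd d8).
case=> -[e1 e2]; first by rewrite (pI a c) // (pI b d).
by move: ab cd; rewrite (pI a d) // (pI b c) //; lia.
Qed.

Lemma hampath_relabel p M : relabelling p -> hampath M -> hampath (map (relabel p) M).
Proof.
case/andP => pp ends [s s6 ps].
have sp : size p = 8 by rewrite (perm_size pp).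
have : path (fun a b => edge a b \in map (relabel p) M) (nth 0 p 0)
         (rcons (map (nth 0 p) s) (nth 0 p 7)).
  rewrite -map_rcons path_map; apply: sub_path ps => a b abM /=.
  by rewrite -relabel_edge map_f.
have : perm_eq (nth 0 p 0 :: rcons (map (nth 0 p) s) (nth 0 p 7)) (0 :: rcons (iota 1 6) 7).
  rewrite -map_rcons -[_ :: _]/(map (nth 0 p) (0 :: rcons s 7)); apply: perm_trans _ pp.
  rewrite -{2}(mkseq_nth 0 p) /mkseq sp; apply: perm_map.
  by rewrite -[iota 0 8]/(0 :: rcons (iota 1 6) 7) perm_cons -!cats1 perm_cat2r.
rewrite !inE !xpair_eqE in ends; move/permP.
case/orP: ends => /andP[/eqP-> /eqP->]; set q := map _ _ => q6 pq.
  exists q => //; apply/permP => a; move: (q6 a).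
  by move: (iota 1 6) => l; rewrite -!cats1 /= !count_cat /=; lia.
exists (rev q).
  apply/permP => a; move: (q6 a).
  by move: (iota 1 6) => l; rewrite count_rev -!cats1 /= !count_cat /=; lia.
move: pq; have := rev_path (fun a b => edge a b \in map (relabel p) M) 7 (rcons q 0).
rewrite last_rcons belast_rcons rev_cons => ->.
by apply: sub_path => a b; rewrite edgeC.
Qed.

Definition paths8 : seq (seq code) := [seq trail 0 r 7 | r <- routes [seq (i, i) | i <- iota 1 6]].

Lemma paths8_hampath w M : w \in paths8 -> {subset w <= M} -> hampath M.
Proof.
case/mapP => r rr -> wM.
have single i : i \in r -> i.2 = i.1.
  case/(mem_routes rr) => /mapP[k _]; first by move->.
  by case: i => a b [-> ->].
have flat (t : seq (nat * nat)) : flatten [seq [:: i.1] | i <- t] = [seq i.1 | i <- t].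
  by elim: t => //= i t ->.
exists [seq i.1 | i <- r].
  have := routes_perm (ex := fun i => [:: i.1]) _ rr; rewrite !flat -map_comp map_id.
  by apply=> i /mapP[k _ ->].
rewrite -flat; apply: (trail_path (lab := id) (ex := fun i => [:: i.1]) (v := 7)).
  by move=> i /single ii; exists [::]; rewrite ii.
by move=> a b /wM.
Qed.

(** * Checking the certificate for K_8 minus an edge *)

Definition position : Type := (seq code * seq code)%type.

Definition winning (p : position) : Prop :=
  mwin hampath p.1 p.2 /\ all (is_edge 8) p.2.

Delimit Scope dec_uint_scope with uint.

(** Certificate data are packed into numerals; [Number.uint] retains the digits, so unpacking them
    takes no arithmetic. *)
Fixpoint decimal_digits (u : Decimal.uint) : seq nat :=
  match u with
  | Decimal.Nil => [::]
  | Decimal.D0 u => 0 :: decimal_digits u | Decimal.D1 u => 1 :: decimal_digits u | Decimal.D2 u => 2 :: decimal_digits u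
  | Decimal.D3 u => 3 :: decimal_digits u | Decimal.D4 u => 4 :: decimal_digits u | Decimal.D5 u => 5 :: decimal_digits u
  | Decimal.D6 u => 6 :: decimal_digits u | Decimal.D7 u => 7 :: decimal_digits u | Decimal.D8 u => 8 :: decimal_digits u
  | Decimal.D9 u => 9 :: decimal_digits u
  end.

Definition digits (u : Number.uint) : seq nat :=
  if u is Number.UIntDecimal d then decimal_digits d else [::].

(* The edge {i, j} with i < j is written ji, so that no numeral starts with 0 *)
(* (0 itself stands for the empty set of edges).                              *)
Fixpoint edges_of (s : seq nat) : seq code :=
  if s is j :: i :: s' then (i, j) :: edges_of s' else [::].

(* Maker's reply, followed by the relabelling that turns the position with    *)
(* the given index in the list of the previous level into one that he gets.   *)
Definition reply_of (u : Number.uint) : code * seq nat * nat :=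
  let s := digits u in
  ((nth 0 s 1, nth 0 s 0), take 8 (drop 2 s), foldl (fun n d => 10 * n + d) 0 (drop 10 s)).

(** The search receives the missing parts of the Hamiltonian paths inside [M] and [C]. Depth 5
    admits those seven-edge paths that contain at least two of Maker's four edges. *)
Definition check_leaf (l : Number.uint * Number.uint) : option position :=
  let M := edges_of (digits l.1) in
  let C := edges_of (digits l.2) in
  let W := [seq [seq e <- w | ~~ in_code e M]
           | w <- paths8 & all (fun e => in_code e M || in_code e C) w] in
  if solve 5 W is Some c then if all (is_edge 8) c then Some (M, c) else None
  else None.

(** A symmetry carries a known won position to the present one. Maker may own more than the image of
    [M'], since additional edges never hurt him. *)
Definition check_reply (prev : seq position) (M : seq code) (u : Number.uint) :
    option (code * seq code) :=
  let: (f, p, i) := reply_of u in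
  if onth prev i is Some (M', C') then
    let c := map (relabel p) C' in
    if [&& relabelling p, is_edge 8 f, ~~ in_code f c &
           all (in_code^~ (f :: M)) (map (relabel p) M')]
    then Some (f, c) else None
  else None.

(** Rejected replies are dropped, so correctness rests on those kept. Testing the edges of the union
    of their boards suffices, because any other edge is avoided by every board. *)
Definition check_node (prev : seq position) (nd : Number.uint * seq Number.uint) : option position :=
  let M := edges_of (digits nd.1) in
  let ks := pmap (check_reply prev M) nd.2 in
  let C := carrier ks in
  if ~~ nilp ks && all (fun e => ~~ all (fun k => in_code e (k.1 :: k.2)) ks) C
  then Some (M, C) else None.

Lemma pmap_Some (A : Type) (B : eqType) (h : A -> option B) s y :
  y \in pmap h s -> exists x, h x = Some y.
Proof.
elim: s => //= x s IH; case hx: (h x) => [z|] //=.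
by rewrite inE => /predU1P[->|//]; exists x.
Qed.

Lemma check_leaf_winning l p : check_leaf l = Some p -> winning p.
Proof.
rewrite /check_leaf; set M := edges_of _; set W := map _ _.
case sW: solve => [c|//]; case: ifP => // c8 [<-]; split=> //=.
have [w _] := solve_sound sW; rewrite -(cats0 M).
apply: mwin_cat hampath_monotone _ w => N [_ /mapP[w + ->] wN].
rewrite mem_filter => /andP[_ /paths8_hampath]; apply=> e we; rewrite mem_cat.
by case: (boolP (e \in M)) => //= eM; apply: wN; rewrite mem_filter in_codeE eM.
Qed.

Lemma check_reply_winning prev M u k :
    {in prev, forall p, winning p} -> check_reply prev M u = Some k ->
  [/\ k.1 \notin k.2, mwin hampath (k.1 :: M) k.2 & all (is_edge 8) (k.1 :: k.2)].
Proof.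
move=> prevP; rewrite /check_reply; case: reply_of => -[f p] i.
case pi: onth => [[M' C']|//]; case: ifP => // /and4P[pp f8 fC /allP sM] [<-] /=.
rewrite in_codeE in fC.
have /prevP[/= w /allP C8] : (M', C') \in prev.
  by apply/onthP; exists i.
split=> //.
  have w' := mwin_map (0, 0) hampath_monotone (fun N => hampath_relabel pp) _ w.
  apply: (mwin_sub hampath_monotone (w' _)) => //.
    by move=> a b /C8 a8 /C8 b8; apply: (relabel_inj pp).
  by move=> g /sM; rewrite in_codeE.
rewrite f8; apply/allP => _ /mapP[e /C8 + ->]; exact: relabel_is_edge.
Qed.

Lemma check_node_winning prev nd p :
  {in prev, forall p, winning p} -> check_node prev nd = Some p -> winning p.
Proof.
move=> prevP; rewrite /check_node; set M := edges_of _; set ks := pmap _ _.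
case: ifP => // /andP[ks0 /allP miss] [<-].
have ksP k : k \in ks ->
    [/\ k.1 \notin k.2, mwin hampath (k.1 :: M) k.2 & all (is_edge 8) (k.1 :: k.2)].
  by case/pmap_Some => u; apply: check_reply_winning.
split; last first.
  apply/allP => e; rewrite mem_carrier => /hasP[k /ksP[_ _ /allP k8]]; exact: k8.
apply: (mwin_responses hampath_monotone (ks := ks)) => [e|k ks_k].
  case: (boolP (e \in carrier ks)) => [/miss/allPn[k ks_k]|].
    by rewrite in_codeE; exists k.
  rewrite mem_carrier -all_predC => /allP eks.
  have [k ks_k] : exists k, k \in ks.
    by case: (ks) ks0 => // k ks1 _; exists k; apply: mem_head.
  by exists k => //; apply: eks.
have [k1 w _] := ksP k ks_k; split=> // e ke.
by rewrite mem_carrier; apply/hasP; exists k.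
Qed.

Lemma pmap_winning (A : Type) (check : A -> option position) s :
    (forall x p, check x = Some p -> winning p) ->
  {in pmap check s, forall p, winning p}.
Proof. by move=> checkP p /pmap_Some[x /checkP]. Qed.

(* Found by a computer search.  In positionsK Maker owns K edges, and the     *)
(* replies lead to the next list, from positions3 to leaves.  In a leaf he    *)
(* owns four edges, and the second component is a board that suffices.        *)
Definition leaves : seq (Number.uint * Number.uint) := [::
    (61425243, 1020405060517162725363736465); (61527243, 103040603141515363546465);
    (21416354, 2030603161326272537364657576);
    (31516142, 203050605262724353546474657576);
    (61325243, 2040502141517163735464657576);
    (31615243, 102030405060414262725374657576);
    (61425253, 1020306031415171626373647476);
    (31614252, 203040506062725373546474657576);
    (31614252, 203040605172435363735464747576);
    (61325243, 204050602131517172637354647475);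
    (61425243, 102030506031517172637354646575);
    (51613242, 3060314152624353735464747576); (50613242, 4151715262435363735464746576);
    (61425263, 102030504171435373546474657576);
    (61324254, 102030506031716272436373657576);
    (41325364, 10205060316171425262724363547576);
    (41513262, 203040506042527263736474657576);
    (51326243, 10203040506041714272635464657576);
    (41513262, 2030607142524353635464746575);
    (41513262, 203040506142524353635464747576);
    (41516243, 10205060713242536373546474657576);
    (31416265, 1020305060517132425243536354647476);
    (41515262, 304050603161427243536373546474);
    (31416265, 204050517132425272536373647475);
    (31514262, 2040506041617132527243536373647475);
    (31426253, 2040604151617132527263736474657576);
    (31413262, 2040505161714252724353636474657576);
    (31615264, 30405021415171324272637374657576);
    (31615254, 20304050602141514262726373647465);
    (31615254, 203040604171326272637364747576);
    (31615243, 20305060214151627263735464746575);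
    (31614252, 4050602141517132626373546474657576);
    (40316152, 2141713262725363735464657576);
    (50615243, 30406021415171324272536373647465);
    (31615243, 20405060214142625363546474657576);
    (61324365, 20304050314171426272537354647475);
    (51615243, 20304050603141627263735464747576)]%uint.

Definition positions3 : seq (Number.uint * seq Number.uint) := [::
  (215364, [::
    76016354271; 20732461501; 74014356271; 10731462501]);
  (516243, [::
    530234516714; 420126435714; 320126345714; 71021345671; 10721345601]);
  (516243, [::
    53023154670; 63013264570; 61731265400; 52732156400; 42012346570; 41721345600]);
  (415162, [::
    53021345676; 63761254308; 53065431276; 53752146305; 32021345677; 320123456716;
    637312546013; 53765431206]);
  (513262, [::
    43013624570; 41012436578; 41012436577; 430126345714; 43713624500]);
  (513262, [::
    417613452013; 43021345675; 410316452713; 43712436500; 417316542013; 43713624500]);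
  (415162, [::
    43061435274; 43761435204; 430215436714; 327613542013; 53752146305]);
  (415162, [::
    43061435274; 320126453716; 43061435279; 43021345670; 53721345606; 43764531206]);
  (415162, [::
    43743215602; 43724153604; 43064531276; 43024513670; 320613452713; 630312546713]);
  (513262, [::
    410123546719; 430523416717; 43021345675; 430126345714; 64716324500; 42021356473;
    43012436570]);
  (513262, [::
    43721345605; 437136245010; 42021356473; 410613452713; 547124635013; 400123645712]);
  (415162, [::
    43061435274; 430163452720; 43061435279; 53021345676; 430215436714; 320123456718]);
  (516243, [::
    61046521376; 41724153604; 61741625309; 610315624714; 71021345671]);
  (314162, [::
    52721634508; 51016423573; 51712463503; 520125346716; 51012563473; 537615342010;
    51716523403]);
  (314162, [::
    65716425308; 537213564017; 65761234508; 51016324573; 65061234577; 520615432713;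
    51716325403]);
  (315162, [::
    64716524308; 41716325403; 41712564303; 43012346575; 41712465303; 427124356018]);
  (314162, [::
    657124356021; 547615432010; 650215436713; 51712463503; 520615432713; 54716452305;
    520125346718]);
  (415162, [::
    53765431206; 53065431276; 53021345676; 53721345606; 530653142714; 53712536405;
    53716532405; 320425631713; 320123456716; 327123654011]);
  (516243, [::
    41724153604; 41016432575; 650451623714; 61746512300; 41764531206]);
  (516243, [::
    310215346714; 41761435209; 53036512475; 65745216306; 42754632106; 31763541206]);
  (516243, [::
    41721354606; 41716432505; 42712364506; 530524316720; 41721345600; 31063541276]);
  (516243, [::
    42014263574; 61046512370; 41721345600; 65062451372; 31021453676]);
  (516243, [::
    41761435204; 317614352010; 52042516374; 41724513600; 31763541206]);
  (415162, [::
    43764531206; 43043215672; 43064531276; 31012564373; 320123456716; 43742156305;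
    43716432505; 327215463011]);
  (314162, [::
    53721543606; 520214356711; 527213564018; 54045213672; 53716352405; 500214356712]);
  (415162, [::
    31016425373; 320215436711; 43024153674; 327214635019; 520123456722; 300215436712]);
  (314162, [::
    527214356011; 757213456012; 51712564303; 53063451276; 500214356712]);
  (314162, [::
    54761453204; 520214356711; 520423561713; 427125346022; 51016423573; 54742136505;
    527214356011]);
  (415262, [::
    317213465011; 317213456011; 310423561713; 310125346718; 510213654722; 300126534712]);
  (314162, [::
    650124356723; 54024135674; 53723415600; 53023145674; 520214365711; 51012564373]);
  (314162, [::
    527214356011; 53721543606; 54724315600; 54721534606; 657215346013]);
  (415162, [::
    630125436723; 43761435204; 53761534204; 327215463011; 31712365403; 327214365018]);
  (314262, [::
    530123456725; 517216543024; 53032164578; 510416352713; 510123654724; 510163542723;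
    52021536473; 510215364711]);
  (316254, [::
    32042316579; 41021534676; 20712456301; 10721453601]);
  (316254, [::
    42014265374; 61756132404; 41021534676; 52712456300; 51025314670; 71021453671]);
  (313262, [::
    54726531402; 547421365010; 547521364010; 417213654026; 517213645026; 540426315714;
    540526314714; 410123456726; 54752163406]);
  (316254, [::
    63735624105; 61756132404; 20712456301; 10721453601]);
  (316254, [::
    41724135604; 52015264374; 61051236476; 71021453671; 20712456301]);
  (316152, [::
    54715624308; 41015326473; 54015624378; 54015342677; 540123456729; 420352146715;
    540123456728; 640123456727; 41715326403]);
  (615243, [::
    510352164714; 32012345674; 51753164205; 54764523109; 63053164270; 30713254601]);
  (615243, [::
    310153426730; 310356142720; 210236154720; 65736251400; 31732165405; 30713254601]);
  (615243, [::
    32763524100; 32762435100; 54064523174; 417541623017; 210132546730; 32063254174]);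
  (615243, [::
    31753641206; 32762435100; 31732165405; 63026413576; 50715342601]);
  (615243, [::
    31751346204; 31721463506; 510456123710; 32762345109; 30713254601]);
  (316152, [::
    327124635022; 42712645308; 43053641276; 54015624378; 427213645011; 400513642712]);
  (615243, [::
    627632541030; 217132546030; 54065432174; 32063254174; 32062345174; 54064523174;
    50715342601]);
  (615243, [::
    31023164574; 627632541030; 51741265306; 310153426730; 63053164270; 31721463506]);
  (614252, [::
    317216543019; 537654231010; 310214365731; 32026415373; 310123456731; 310264315729;
    317143526028; 630624513711; 317213654011]);
  (406152, [::
    310153426732; 530653241712; 310513642712; 630263145712; 320123546712; 43714253601]);
  (614252, [::
    300125436712; 310146352723; 317213654011; 317213546019; 410213546722; 300625431712]);
  (615243, [::
    500124356733; 42014253679; 41054163274; 62025461372; 31023164574; 60726341501]);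
  (613252, [::
    42026315473; 547653241010; 410125643719; 417216534019; 410124356731; 417243615028;
    410156432723; 410134526728; 640623514711]);
  (615243, [::
    310321654734; 21042165374; 32062345174; 50715342601; 41751436204; 20712345601]);
  (614365, [::
    327361425019; 21713654205; 21714653205; 21065412372; 420465132711; 320123456735;
    200645231732]);
  (615243, [::
    637236154017; 63034561272; 51052416372; 76026341571; 50715342601]);
  (216143, [::
    65712365402; 540412653711; 530312654711; 52025316472; 500416253712]);
  (516143, [::
    427415623011; 420416523711; 630132564722; 420415632711; 520124356736; 427416532011]);
  (615263, [::
    41714563202; 41056431276; 41063214572; 427643521028; 420263154711; 540563124711;
    540145236735; 41751346206]);
  (615243, [::
    41721364506; 41751364206; 62025361472; 31721463506; 62032165470; 60726341501])]%uint.

Definition positions2 : seq (Number.uint * seq Number.uint) := [::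
  (5162, [::
    417123546011; 410123546711; 437123456012; 430123456712; 417123456011; 410123456711;
    327123456010; 320123456710; 41012354676; 32712345609; 32012345679; 41712345608;
    41012345678; 41012345677; 41012345676; 41021536474; 32012345675; 32012345674;
    41012354673; 43013265471; 41012345673; 43012345672; 43012345671]);
  (3162, [::
    410124356716; 417124356016; 517123546016; 417123456016; 510123546716; 410123456716;
    42012653479; 420126534710; 42712653409; 417123546015; 510123456715; 410124356713;
    510125346713; 410163452714; 410123456714; 410123456713; 52012643575; 42012653475;
    42012653474; 52012643574; 54015263471; 54014263571; 427126534010]);
  (5162, [::
    430546213722; 437546213022; 437546213021; 430546213721; 437546213020; 430546213720;
    437123456022; 430123456722; 437123456021; 430123456721; 437123456020; 430123456720;
    430123456719; 53056413276; 41012345677; 42021346576; 430123456718; 310124536717;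
    41021536475; 41021436575; 410123456717; 31012453673; 310123546713]);
  (4162, [::
    510123456731; 310124356730; 510125436730; 310123456730; 310124356724; 310123456729;
    520123456728; 310123456727; 310123456726; 510123456725; 510125436724; 310123456724;
    310125346723; 510123546723; 530634125720; 530654123720; 310214563710; 510123456723;
    510215364710; 310213564710; 51712345608; 31712534608; 317123546015]);
  (3162, [::
    540123456737; 540123456736; 320123456735; 427215463031; 540123546734; 540123456734;
    410123456724; 420214653729; 540123546733; 540123456733; 430364152727; 410124356716;
    420123654732; 520123645732; 540124536721; 540125436721; 41721356409; 510124356711;
    410125346711; 547215463012; 547214563012; 420123456732; 417123456030]);
  (6152, [::
    437532164034; 430123456746; 430532164733; 430123456745; 310123456744; 437354162034;
    430145236743; 430354162733; 420621534732; 430123456743; 430145236742; 430123456742;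
    430123456741; 430351642722; 437563421012; 430356142720; 310513426710; 437365241012;
    430135246740; 430123456740; 430123456739; 310123456738; 310126345727]);
  (6152, [::
    430213465750; 430123456750; 310214365749; 420123456749; 430562341736; 320263541729;
    310214635747; 410213645747; 320124536747; 420123546747; 300124356748; 400123456748;
    310124365725; 430241635742; 430231645742; 430142536742; 430132546742; 420123456747;
    310153642729]);
  (6152, [::
    430513462750; 437623451050; 317214365049; 320124356749; 437214365052; 437213465052;
    430124356752; 430123456752; 430651342737; 327264351031; 310154362731; 317216435051;
    417216345051; 320125436751; 420125346751; 317214536028; 437231645043; 437241635043;
    430142536743; 430132546743; 320123456751; 43025314670]);
  (6143, [::
    52034215670; 620623451755; 210123456755; 210146253724; 520132546754; 520142536754;
    210136254724; 500132546748; 520132546745; 520123456745; 520124356745; 520142536745;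
    520153426754; 520623451754; 520653421754; 520123456754; 650123456753; 200135246748]);
  (5161, [::
    327152346055; 320152346755; 320162345755; 427413562049; 327314562049; 327214563049;
    420413562749; 320314562749; 320214563749; 520651342735; 420126345744; 320126435744;
    320136425744; 420125346744; 320125436744; 320135426744; 420145632726; 320135642726;
    320125643726; 320143256756; 320142356756; 430123456756; 327162345055]);
  (6152, [::
    430153426750; 437623451050; 430123456750; 437653421050; 630632541755; 437642531050;
    437632541050; 430142536750; 430132546750; 430135246758; 430132546758; 310156342730;
    310126345730; 430124356746; 430142536746; 430123456746; 430132546746; 437624351058;
    437623451058; 430124356758; 430123456758; 630123456757; 317132546055])]%uint.

Definition positions1 : seq (Number.uint * seq Number.uint) := [::
  (62, [::
    31721645304; 31021645374; 51712534604; 41712435604; 31712345604; 51012534674;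
    41012435674; 31012345674; 31021465373; 31721465303; 31712435603; 41012345673;
    41021536472; 31021546372; 31021456372; 31012453672; 31012543672; 51012345672;
    31021546370; 31012345671; 41021356470; 31021456370; 31012543670; 31012453670;
    51012345670]);
  (61, [::
    520123456710; 51012345679; 43012345678; 52015342677; 42014352677; 32013452677;
    52012345677; 52015342676; 42014352676; 32013452676; 52012345676; 42064135274;
    32062145374; 52065134274; 32013465273; 52015364273; 32012465373; 42014365273;
    42012534675; 32013542675; 32013452675; 42014352675; 32012453675; 52012345675;
    32063145274])]%uint.

Definition positions0 : seq (Number.uint * seq Number.uint) := [::
  (0, [::
    61762345101; 51752346101; 41742356101; 31732456101; 21723456101; 21713456201;
    61062345171; 51052346171; 41042356171; 31032456171; 21023456171; 61012345671;
    51065234170; 41064235170; 41054236170; 31063245170; 31053246170; 31043256170;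
    21062345170; 21052346170; 21042356170; 21032456170; 21061345270; 21051346270;
    21041356270; 21031456270; 62012345670])]%uint.

(** * The outcomes of the two finite games *)

Definition winning0 : seq position :=
  pmap (check_node
    (pmap (check_node
      (pmap (check_node
        (pmap (check_node
          (pmap check_leaf leaves)) positions3)) positions2)) positions1)) positions0.

Definition board (n k : nat) (excl C : seq code) : bool :=
  [&& size C <= k, uniq C & all (fun e => is_edge n e && ~~ in_code e excl) C].

Lemma K8_win : exists2 C, mwin hampath [::] C & board 8 27 [:: (0, 7)] C.
Proof.
have all_winning : {in winning0, forall p, winning p}.
  do 4![apply: pmap_winning => ? ?; apply: check_node_winning].
  by apply: pmap_winning; apply: check_leaf_winning.
(* The position sought is the initial one, where Maker owns nothing; 27 counts the edges of K_8
   other than [(0, 7)]. *)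
have : has (fun p => nilp p.1 && board 8 27 [:: (0, 7)] p.2) winning0.
  by vm_compute.
by case/hasP => -[M C] /all_winning[/= w _] /andP[/nilP M0 bC]; exists C; rewrite // -M0.
Qed.

(* 0 and 6 are the ends, (1, 2) and (3, 4) the links, 5 the additional vertex. *)
Definition bridges : seq (seq code) := [seq trail 0 r 6 | r <- routes [:: (1, 2); (3, 4); (5, 5)]].

Lemma solve_win n W (Q : pred (seq code)) : oapp Q false (solve n W) ->
  exists2 C, mwin (claims_one W) [::] C & Q C.
Proof. by case sW: solve => [C|//] QC; exists C => //; case: (solve_sound sW). Qed.

(** The bound is 18 = 21 - 3, the edges of K_7 without the two contracted links and the edge between
    the new ends. A route has four edges, so depth 6 leaves two moves to spare. *)
Lemma bridge_win :
  exists2 C, mwin (claims_one bridges) [::] C & board 7 18 [:: (0, 6); (1, 2); (3, 4)] C.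
Proof. by apply: (@solve_win 6); vm_compute. Qed.

(** * Links on arbitrary vertices and the ways to combine them *)

Section Links.

Variable V : finType.
Implicit Types (x y : V) (s t : seq V) (M E : seq {set V}).

Definition joined M : rel V := fun x y => [set x; y] \in M.

Definition spanning_path x t M : Prop :=
  exists s, [/\ perm_eq s t, last x s = last x t & path (joined M) x s].

Definition within t (e : {set V}) : Prop :=
  exists x y, [/\ x \in t, y \in t, x != y & e = [set x; y]].

(* The edge between the ends x and last x t is excluded so that E does not    *)
(* meet a second link with the same two ends.                                 *)
Definition link x t E : Prop :=
  (forall e, e \in E -> within (x :: t) e /\ e != [set x; last x t]) /\
  mwin (spanning_path x t) [::] E.

Lemma spanning_path_monotone x t : monotone (spanning_path x t).
Proof.
move=> M M' sM [s [st ls ps]]; exists s; split=> //.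
by apply: sub_path ps => a b; apply: sM.
Qed.

Lemma set2_inj (a b c d : V) : [set a; b] = [set c; d] -> a = c /\ b = d \/ a = d /\ b = c.
Proof.
move=> /setP eq2; have := eq2 a; have := eq2 b; have := eq2 c; have := eq2 d.
rewrite !inE !eqxx !orbT /=.
move=> /orP[]/eqP dE /orP[]/eqP cE /esym/orP[]/eqP bE /esym/orP[]/eqP aE; subst; auto.
Qed.

Lemma within_set2 s (a b : V) : within s [set a; b] -> a \in s /\ b \in s.
Proof. by move=> [x [y [xs ys _ /set2_inj[] [-> ->]]]]. Qed.

Lemma within_both s t (e : {set V}) : within s e -> within t e ->
  exists x y, [/\ x != y, e = [set x; y], (x \in s) && (x \in t) & (y \in s) && (y \in t)].
Proof.
move=> [x [y [xs ys xy exy]]] [a [b [at_ bt _ eab]]]; exists x, y; split=> //.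
all: by move: eab; rewrite exy => /set2_inj[] [? ?]; subst; rewrite ?xs ?ys.
Qed.

Lemma within_sub s t (e : {set V}) : {subset s <= t} -> within s e -> within t e.
Proof. by move=> st [x [y [xs ys xy ->]]]; exists x, y; split; auto. Qed.

Definition label_edge (lab : nat -> V) (e : code) : {set V} := [set lab e.1; lab e.2].

Lemma label_edge_edge lab a b : label_edge lab (edge a b) = [set lab a; lab b].
Proof. by rewrite /label_edge /edge /=; case: (leqP a b) => // _; rewrite setUC. Qed.

Lemma label_edge_inj lab n : {in gtn n &, injective lab} ->
  {in is_edge n &, injective (label_edge lab)}.
Proof.
move=> labI [a b] [c d] /andP[/= ab bn] /andP[/= cd dn] /set2_inj /=.
have [an cn] := (ltn_trans ab bn, ltn_trans cd dn).
case=> -[/labI e1 /labI e2]; first by rewrite e1 // e2.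
by move: ab cd; rewrite e1 // e2 //; lia.
Qed.

Lemma link_K8 x t : uniq (x :: t) -> size t = 7 -> exists2 E, link x t E & size E <= 27.
Proof.
move=> uxt st; have [C w /and3P[sC _ /allP C8]] := K8_win.
pose lab := nth x (x :: t); exists (map (label_edge lab) C); last by rewrite size_map.
have labI : {in gtn 8 &, injective lab}.
  by move=> i j i8 j8 /eqP; rewrite nth_uniq ?[size _]/= ?st // => /eqP.
have lastE : last x t = lab 7 by rewrite /lab -[7]st nth_last.
have labs i : i < 8 -> lab i \in x :: t by move=> i8; rewrite mem_nth //= st.
split.
  move=> _ /mapP[[i j] /C8/andP[ij8] + ->]; rewrite in_codeE mem_seq1 => ij07.
  have /andP[/= ij j8] := ij8; have i8 := ltn_trans ij j8; split.
    exists (lab i), (lab j); rewrite !labs //; split=> //.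
    by apply: contraTneq ij => /labI->; rewrite ?ltnn.
  rewrite lastE -[x]/(lab 0); apply: contra ij07 => /eqP ij07.
  by apply/eqP/(label_edge_inj labI).
apply: (mwin_map (0, 0) (@spanning_path_monotone x t) _ _ w) => [M [s s6 ps]|].
  exists (rcons (map lab s) (lab 7)).
  rewrite last_rcons; split=> //.
    have -> : t = rcons (map lab (iota 1 6)) (lab 7).
      rewrite -map_rcons; apply: (@eq_from_nth _ x) => [|i]; first by rewrite size_map.
      by rewrite st => i7; rewrite (nth_map 0) //; move: i i7; do 7![case=> //].
    by rewrite -!cats1 perm_cat2r perm_map.
  rewrite -[x]/(lab 0) -map_rcons path_map; apply: sub_path ps => a b abM /=.
  by rewrite /joined -label_edge_edge map_f.
by move=> e f /C8/andP[e8 _] /C8/andP[f8 _]; apply: (label_edge_inj labI).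
Qed.

(** A common edge would have two distinct ends among the common vertices, of which there is at most
    one. *)
Lemma link_disjoint x s y t E E' :
    {in x :: s, forall c, c \in y :: t -> c = y} ->
  link x s E -> link y t E' -> {in E, forall e, e \notin E'}.
Proof.
move=> only [Ew _] [E'w _] e /Ew[we _]; apply/negP => /E'w[we' _].
have [a [b [ab _ /andP[ax ay] /andP[bx by_]]]] := within_both we we'.
by rewrite (only a) // (only b) // eqxx in ab.
Qed.

Lemma link_series x s t E E' : 0 < size s -> 0 < size t -> uniq (x :: s ++ t) ->
  link x s E -> link (last x s) t E' -> link x (s ++ t) (E ++ E').
Proof.
move=> s0 t0 ust lE lE'; set y := last x s in lE' *.
have ys : y \in s by rewrite /y; case: (s) s0 => //= a s' _; apply: mem_last.
have zt : last y t \in t by case: (t) t0 => //= a t' _; apply: mem_last.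
move: ust; rewrite cons_uniq mem_cat negb_or cat_uniq => /and4P[/andP[xs xt] us /hasPn st ut].
have xy : x != y by apply: contraNneq xs => ->.
have E_E' : {in E, forall e, e \notin E'}.
  apply: link_disjoint lE lE' => c; rewrite !inE => /orP[/eqP->|cs] /orP[/eqP->//|ct]; first by rewrite ct in xt.
  by have := st _ ct; rewrite cs.
have [[Ew w] [E'w w']] := (lE, lE'); split.
  (* No edge joins the new ends: the far end is not a vertex of the first link, and [x] is not one
     of the second. *)
  rewrite last_cat -/y => e; rewrite mem_cat => /orP[/Ew|/E'w] [we _]; split.
  - by apply: within_sub we => c; rewrite !inE mem_cat => /orP[->|->]; rewrite ?orbT.
  - apply: contraTneq zt => eE; move: we; rewrite eE => /within_set2[_].
    by rewrite inE => /predU1P[->//|zs]; apply/negP => /st; rewrite zs.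
  - apply: within_sub we => c; rewrite !inE mem_cat => /orP[/eqP->|->]; rewrite ?orbT //.
    by rewrite ys orbT.
  - apply: contraNneq xt => eE; move: we; rewrite eE => /within_set2[+ _].
    by rewrite inE (negPf xy).
apply: mwin_impl (mwin_and (@spanning_path_monotone x s) (@spanning_path_monotone y t)
  w w' E_E' _ _ _ _) => //.
- move=> M [[s1 [p1 l1 q1]] [s2 [p2 l2 q2]]]; exists (s1 ++ s2).
  by rewrite perm_cat // !last_cat l1 cat_path q1 l1 -/y.
- by move=> e; rewrite mem_cat => ->.
- by move=> e; rewrite mem_cat => ->; rewrite orbT.
Qed.

(** Maker plays three disjoint games, one on each link and the bridging game on the link ends and
    [x], [w], [v]. His route there visits each contracted link once, and the path won on that link
    is inserted in the direction of traversal. *)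
Lemma link_bridge x a s b t w v E1 E2 :
    0 < size s -> 0 < size t -> uniq (x :: (a :: s) ++ (b :: t) ++ [:: w; v]) ->
    link a s E1 -> link b t E2 ->
  exists2 E, link x ((a :: s) ++ (b :: t) ++ [:: w; v]) E &
    size E <= size E1 + size E2 + 18.
Proof.
move=> s0 t0 u l1 l2; have [C wC /and3P[sC _ /allP C7]] := bridge_win.
set a' := last a s; set b' := last b t.
have a's : a' \in s by rewrite /a'; case: (s) s0 => //= c s' _; apply: mem_last.
have b't : b' \in t by rewrite /b'; case: (t) t0 => //= c t' _; apply: mem_last.
pose labs := [:: x; a; a'; b; b'; w; v]; pose lab := nth x labs.
set p := (a :: s) ++ _ in u *.
have [[xp us ut wv] [ast bwv]] :
    [/\ x \notin p, uniq (a :: s), uniq (b :: t) & uniq [:: w; v]] /\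
    {in a :: s, forall c, c \notin b :: t} /\
    {in [:: w; v], forall c, (c \notin a :: s) && (c \notin b :: t)}.
  move: u; rewrite /p cons_uniq cat_uniq cat_uniq has_cat negb_or => /and3P[-> ->].
  case/and3P => /andP[/hasPn h1 /hasPn h2] -> /andP[/hasPn h3 ->]; split=> //.
  split=> c cs.
    by apply/negP => /h1; rewrite /= cs.
  by rewrite h2 ?h3.
have p_eq c : c \in p = [|| c \in a :: s, c \in b :: t | c \in [:: w; v]] by rewrite !mem_cat.
have mem_labs c : c \in labs -> c \in x :: p.
  rewrite inE [_ \in _ :: p]inE p_eq; case: (c == x) => //= => cl.
  move: cl; rewrite !inE.
  by case/or4P => [->|/eqP->|->|/orP[/eqP->|->]]; rewrite ?a's ?b't ?orbT.
have aa : a != a' by apply: contraTneq us => ->; rewrite /= a's.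
have bb : b != b' by apply: contraTneq ut => ->; rewrite /= b't.
have as' : {subset [:: a; a'] <= a :: s}.
  by move=> c; rewrite !inE => /orP[->//|/eqP->]; rewrite a's orbT.
have bt' : {subset [:: b; b'] <= b :: t}.
  by move=> c; rewrite !inE => /orP[->//|/eqP->]; rewrite b't orbT.
have ulabs : uniq labs.
  rewrite -[labs]/(x :: [:: a; a'] ++ [:: b; b'] ++ [:: w; v]) cons_uniq.
  apply/andP; split.
    apply: contra xp; rewrite p_eq !mem_cat.
    by case/or3P => [/as'->|/bt'->|->]; rewrite ?orbT.
  rewrite cat_uniq cat_uniq has_cat wv negb_or andbT.
  rewrite [uniq [:: a; a']]/= [uniq [:: b; b']]/= !mem_seq1 aa bb.
  apply/andP; split=> //; apply/andP; split; last first.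
    by apply/andP; split=> //; apply/hasPn => c /bwv/andP[_]; apply: contra; apply: bt'.
  apply/andP; split; apply/hasPn => c.
    by move=> /bt' ct; apply/negP => /as'/ast; rewrite ct.
  by move=> /bwv/andP[+ _]; apply: contra; apply: as'.
have labI : {in gtn 7 &, injective lab}.
  by move=> i j i7 j7 /eqP; rewrite nth_uniq // => /eqP.
have lab_s i : i < 7 -> lab i \in a :: s -> (i == 1) || (i == 2).
  case: i => [|[|[|[|[|[|[|i]]]]]]] //= _ ls.
  - by case/negP: xp; rewrite p_eq ls.
  - by have := ast _ ls; rewrite mem_head.
  - by have := ast _ ls; rewrite inE b't orbT.
  - by have /andP[] := bwv w (mem_head _ _); rewrite ls.
  - by have /andP[] := bwv v (mem_last w [:: v]); rewrite ls.
have lab_t i : i < 7 -> lab i \in b :: t -> (i == 3) || (i == 4).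
  case: i => [|[|[|[|[|[|[|i]]]]]]] //= _ ls.
  - by case/negP: xp; rewrite p_eq ls orbT.
  - by have := ast _ (mem_head a s); rewrite ls.
  - by have := ast a'; rewrite ls inE a's orbT => /(_ isT).
  - by have /andP[] := bwv w (mem_head _ _); rewrite ls.
  - by have /andP[] := bwv v (mem_last w [:: v]); rewrite ls.
pose E3 := map (label_edge lab) C.
have E3P e : e \in E3 -> exists i j, [/\ i < j, j < 7,
    (i, j) \notin [:: (0, 6); (1, 2); (3, 4)] & e = [set lab i; lab j]].
  by case/mapP=> -[i j] /C7/andP[/andP[ij j7]]; rewrite in_codeE => nij ->; exists i, j.
pose its := [:: (1, 2); (3, 4); (5, 5)].
pose bridged M := exists2 r, r \in routes its &
  forall i j, edge i j \in trail 0 r 6 -> joined M (lab i) (lab j).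
have bridged_mono : monotone bridged.
  by move=> M M' sM [r rr rM]; exists r => // i j /rM/sM.
have w3 : mwin bridged [::] E3.
  apply: (mwin_map (0, 0) bridged_mono _ _ wC) => [M [_ /mapP[r rr ->] rM]|e f].
    by exists r => // i j /rM ij; rewrite /joined -label_edge_edge map_f.
  by move=> /C7/andP[e7 _] /C7/andP[f7 _]; apply: (label_edge_inj labI).
have E12 : {in E1, forall e, e \notin E2}.
  by apply: link_disjoint l1 l2 => c /ast/negPf->.
have [[E1w w1] [E2w w2]] := (l1, l2).
(* Two labels on the same link are 1 and 2, or 3 and 4: precisely the pairs kept off the bridging
   board. *)
have E123 : {in E1 ++ E2, forall e, e \notin E3}.
  move=> e e12; apply/negP => /E3P[i [j [ij j7 nij eij]]]; have i7 := ltn_trans ij j7.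
  case/negP: nij; move: e12; rewrite eij mem_cat.
  case/orP => [/E1w|/E2w] [/within_set2[li lj] _]; move: ij.
    by case/orP: (lab_s _ i7 li) => /eqP->; case/orP: (lab_s _ j7 lj) => /eqP->.
  by case/orP: (lab_t _ i7 li) => /eqP->; case/orP: (lab_t _ j7 lj) => /eqP->.
exists (E1 ++ E2 ++ E3); last by rewrite !size_cat size_map addnA leq_add2l.
have ps c : c \in a :: s -> c \in x :: p by rewrite [_ \in _ :: p]inE p_eq => ->; rewrite orbT.
have pt c : c \in b :: t -> c \in x :: p by rewrite [_ \in _ :: p]inE p_eq => ->; rewrite !orbT.
have lastp : last x p = v by rewrite /p !last_cat.
have vp : (v \notin a :: s) && (v \notin b :: t) by apply: bwv; rewrite !inE eqxx orbT.
split.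
  rewrite lastp => e; rewrite !mem_cat => /or3P[/E1w|/E2w|/E3P].
  - move=> [we _]; split; first exact: within_sub we.
    by apply: contraTneq vp => eE; move: we; rewrite eE => /within_set2[_ ->].
  - move=> [we _]; split; first exact: within_sub we.
    apply: contraTneq vp => eE; move: we; rewrite eE => /within_set2[_ ->].
    by rewrite andbF.
  - move=> [i [j [ij j7 nij ->]]]; have i7 := ltn_trans ij j7; split.
      exists (lab i), (lab j); split=> //; try by apply/mem_labs/mem_nth.
      by apply: contraTneq ij => /labI->; rewrite ?ltnn.
    apply: contra nij; rewrite -[v]/(lab 6) -[x]/(lab 0) => /eqP/set2_inj[] [/labI e1 /labI e2].
      by rewrite e1 // e2.
    by move: ij; rewrite e1 // e2.
have and_mono : monotone (fun M => spanning_path a s M /\ spanning_path b t M).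
  move=> M M' sM [q1 q2]; split; [exact: spanning_path_monotone q1|].
  exact: spanning_path_monotone q2.
have w12 : mwin (fun M => spanning_path a s M /\ spanning_path b t M) [::] (E1 ++ E2).
  apply: (mwin_and (@spanning_path_monotone a s) (@spanning_path_monotone b t) w1 w2 E12)
    => // e; rewrite mem_cat => ->; rewrite ?orbT //.
apply: (mwin_impl _ (mwin_and (M0 := [::]) (C0 := E1 ++ E2 ++ E3)
  and_mono bridged_mono w12 w3 E123 _ _ _ _)) => //; last 2 first.
- by move=> e e12; rewrite catA mem_cat e12.
- by move=> e e3; rewrite catA mem_cat e3 orbT.
move=> M [[[s1 [sp1 ls1 q1]] [s2 [sp2 ls2 q2]]] [r rr rM]].
(* The items [(2, 1)] and [(4, 3)] are links entered at their far end, so their paths are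
   reversed. *)
pose ex (i : nat * nat) := if i == (1, 2) then a :: s1 else if i == (2, 1) then rev (a :: s1)
  else if i == (3, 4) then b :: s2 else if i == (4, 3) then rev (b :: s2) else [:: w].
have rev_ex c (q : seq V) : path (joined M) c q ->
    exists q', [/\ rev (c :: q) = last c q :: q', path (joined M) (last c q) q' &
                   last (last c q) q' = c].
  move=> pq; exists (rev (belast c q)); split; first by rewrite lastI rev_rcons.
    by rewrite rev_path; apply: sub_path pq => c1 c2; rewrite /joined setUC.
  by case: (q) => //= c1 q3; rewrite rev_cons last_rcons.
exists (rcons (flatten (map ex r)) v).
have rP i : i \in r -> i \in [:: (1, 2); (2, 1); (3, 4); (4, 3); (5, 5)].
  case/(mem_routes rr); rewrite !inE; first by case/or3P => /eqP->.
  by case: i => i j; rewrite /swap /= => /or3P[] /eqP[-> ->].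
split; last 1 first.
- apply: (trail_path (lab := lab) (u := 0) (v := 6)) => [i /rP|i j /rM//].
  rewrite !inE => /or4P[/eqP->|/eqP->|/eqP->|/orP[]/eqP->].
  - by exists s1; rewrite ls1.
  - by have := rev_ex _ _ q1; rewrite ls1.
  - by exists s2; rewrite ls2.
  - by have := rev_ex _ _ q2; rewrite ls2.
  - by exists [::].
- have := @routes_perm _ ex its r _ rr.
  rewrite /p -cats1 -[[:: w; v]]/([:: w] ++ [:: v]) !catA perm_cat2r => pr.
  apply: perm_trans (pr _) _.
    by move=> i; rewrite !inE => /or3P[]/eqP->; rewrite /ex /= ?perm_rev.
  by rewrite /ex /= perm_cons -catA perm_cat //= perm_cons perm_cat2r.
- by rewrite last_rcons lastp.
Qed.

(** The second link runs from y back to x. Its board meets the first at most in the edge xy, which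
    links exclude, so both paths can be won and together form a Hamiltonian cycle. *)
Lemma links_can_win_first x s t E E' : 2 < #|V| -> 0 < size s ->
    uniq (x :: s ++ t) -> (forall c, c \in x :: s ++ t) ->
    link x s E -> link (last x s) (rcons t x) E' ->
  maker_can_win_first [set e in E ++ E'] /\ edge_set [set e in E ++ E'].
Proof.
move=> V2 s0 ust all_st lE lE'; set y := last x s in lE' *; set F := [set e in _].
have ys : y \in s by rewrite /y; case: (s) s0 => //= a s' _; apply: mem_last.
move: (ust); rewrite cons_uniq mem_cat negb_or cat_uniq => /and4P[/andP[xs xt] us /hasPn st ut].
have [[Ew w] [E'w w']] := (lE, lE'); split; last first.
  move=> e; rewrite inE mem_cat => /orP[/Ew|/E'w] [[a [b [_ _ ab ->]]] _];
  by rewrite cards2 ab.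
have E_E' : {in E, forall e, e \notin E'}.
  move=> e eE; apply/negP => /E'w[we' _]; have [we] := Ew e eE; rewrite -/y.
  have [a [b [ab -> /andP[ax ay] /andP[bx by_]]]] := within_both we we'.
  have xy c : c \in x :: s -> c \in y :: rcons t x -> c = x \/ c = y.
    rewrite !inE mem_rcons inE => /orP[/eqP->|cs]; first by left.
    case/or3P => [/eqP|/eqP|ct]; [by right | by left |].
    by have := st _ ct; rewrite cs.
  case: (xy a ax ay) (xy b bx by_) ab => -> [] ->; rewrite ?eqxx // => _.
  by rewrite setUC eqxx.
have w12 := mwin_and (C0 := enum F) (@spanning_path_monotone x s)
  (@spanning_path_monotone y (rcons t x)) w w' E_E' (fun e => id) (fun e => id) _ _.
apply: mwin_can_win_first (w12 _ _) _.
- move=> M M' sM [q1 q2]; split; [exact: spanning_path_monotone q1|].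
  exact: spanning_path_monotone q2.
- by move=> e eE; rewrite mem_enum inE mem_cat eE.
- by move=> e eE; rewrite mem_enum inE mem_cat eE orbT.
move=> M MF [[s1 [sp1 ls1 q1]] [s2 [sp2]]]; rewrite last_rcons.
(* The second path ends at [x], where the cycle starts, so this last vertex is dropped. *)
case/lastP: s2 sp2 => [|s2 z sp2]; first by move/perm_size; rewrite size_rcons.
rewrite last_rcons => zx q2; move: zx sp2 q2 => -> sp2 q2.
have pc : perm_eq (x :: s1 ++ s2) (x :: s ++ t).
  by rewrite perm_cons perm_cat //; move: sp2; rewrite -!cats1 perm_cat2r.
have cM : {subset cycle_edges (x :: s1 ++ s2) <= M}.
  move=> _ /imsetP[a ca ->]; apply: (next_cycle (e := joined M)) ca.
  by rewrite /= rcons_cat cat_path q1 ls1.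
exists (x :: s1 ++ s2) => //; split=> //.
- by rewrite (perm_uniq pc).
- by move=> a; rewrite (perm_mem pc).
- by apply/subsetP => e /cM/MF.
Qed.

End Links.

(** * Edge counts and the bound *)

(** Quantifying over all vertex sequences allows a link to be placed anywhere in a larger graph; [t]
    omits the first end, so d is the number of path edges. *)
Definition linkable (d m : nat) : Prop :=
  0 < d /\ forall (V : finType) (x : V) (t : seq V), uniq (x :: t) -> size t = d ->
    exists2 E, link x t E & size E <= m.

Lemma size_split (T : Type) (s : seq T) m n : size s = m + n ->
  exists s1 s2, [/\ s = s1 ++ s2, size s1 = m & size s2 = n].
Proof.
move=> sz; exists (take m s), (drop m s); rewrite cat_take_drop size_drop sz addKn.
by rewrite size_takel // sz leq_addr.
Qed.

Lemma linkable_7 : linkable 7 27.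
Proof. by split=> // V x t; apply: link_K8. Qed.

Lemma linkable_add d m d' m' : linkable d m -> linkable d' m' -> linkable (d + d') (m + m').
Proof.
move=> [d0 dm] [d'0 dm']; split=> [|V x st]; first by rewrite addn_gt0 d0.
move=> u /size_split[s [t [st_eq sd td]]]; rewrite {}st_eq in u *.
have [us ut] : uniq (x :: s) /\ uniq (last x s :: t).
  move: u; rewrite -cat_cons cat_uniq => /and3P[us /hasPn nst ut]; split=> //=.
  by rewrite ut andbT; apply/negP => /nst; rewrite mem_last.
have [E lE sE] := dm V x s us sd; have [E' lE' sE'] := dm' V _ t ut td.
exists (E ++ E'); last by rewrite size_cat leq_add.
by apply: link_series; rewrite ?sd ?td.
Qed.

Lemma linkable_bridge d m d' m' :
  linkable d m -> linkable d' m' -> linkable (d + d' + 4) (m + m' + 18).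
Proof.
move=> [d0 dm] [d'0 dm']; split=> [|V x p u]; first by rewrite addn_gt0 orbT.
have -> : d + d' + 4 = d.+1 + (d'.+1 + 2) by lia.
move=> /size_split[[|a s] [q [pE // [sd]]]] /size_split[[|b t] [r [qE // [td]]]].
case: r qE => [//|w [//|v [|//]]] qE _; rewrite {}pE {}qE in u *.
have [us ut] : uniq (a :: s) /\ uniq (b :: t).
  by move: u; rewrite cons_uniq !cat_uniq => /and4P[_ -> _ /andP[-> _]].
have [E1 l1 s1] := dm V a s us sd; have [E2 l2 s2] := dm' V b t ut td.
have [E lE sE] : exists2 E, link x ((a :: s) ++ (b :: t) ++ [:: w; v]) E &
    size E <= size E1 + size E2 + 18 by apply: link_bridge; rewrite ?sd ?td.
by exists E => //; apply: leq_trans sE _; rewrite leq_add2r leq_add.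
Qed.

(** Both blocks respect the budget, 27 <= 4 * 7 and 27 + 27 + 18 = 4 * 18, and gluing adds lengths
    and costs alike. *)
Lemma linkable_7_18 a b : linkable (7 * a.+1 + 18 * b) (4 * (7 * a.+1 + 18 * b)).
Proof.
have weaken d m m' : m <= m' -> linkable d m -> linkable d m'.
  move=> mm [d0 dm]; split=> // V x t u td; have [E lE sE] := dm V x t u td.
  by exists E; rewrite // (leq_trans sE).
have l18 := linkable_bridge linkable_7 linkable_7.
elim: b => [|b IH].
  elim: a => [|a IH]; first exact: weaken linkable_7.
  have -> : 7 * a.+2 + 18 * 0 = 7 + (7 * a.+1 + 18 * 0) by lia.
  by rewrite mulnDr; apply: linkable_add IH; apply: weaken linkable_7.
have -> : 7 * a.+1 + 18 * b.+1 = 18 + (7 * a.+1 + 18 * b) by lia.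
by rewrite mulnDr; apply: linkable_add IH.
Qed.

Lemma linkable_can_win_first d m d' m' : linkable d.+1 m -> linkable d'.+2 m' ->
  exists E : {set {set 'I_(d.+1 + d'.+2)}},
    [/\ edge_set E, maker_can_win_first E & #|E| <= m + m'].
Proof.
move=> [_ dm] [_ dm']; set n := _ + _.
have := size_enum_ord n; have := mem_enum 'I_n; have := enum_uniq 'I_n.
case: (enum 'I_n) => [|x st] // u all_st [].
(* Once [x] is set aside, the second link brings only [d'.+1] further vertices, as its sequence
   [rcons t x] ends in [x] again. *)
have -> : d + d'.+2 = d.+1 + d'.+1 by lia.
case/size_split=> s [t [stE sd td]]; rewrite {}stE in u all_st *.
have y_rtx : uniq (last x s :: rcons t x).
  move: u; rewrite -cat_cons cat_uniq => /and3P[ux /hasPn nst ut].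
  rewrite cons_uniq rcons_uniq mem_rcons inE negb_or ut andbT -andbA; apply/and3P; split.
  - case: (s) sd ux => //= a s' _ /andP[+ _]; apply: contraNneq => <-; exact: mem_last.
  - by apply/negP => /nst; rewrite mem_last.
  - by apply/negP => /nst; rewrite mem_head.
have us : uniq (x :: s) by move: u; rewrite -cat_cons cat_uniq => /and3P[].
have [E lE sE] := dm _ x s us sd.
have [|E' lE' sE'] := dm' _ _ (rcons t x) y_rtx; first by rewrite size_rcons td.
have [win es] : maker_can_win_first [set e in E ++ E'] /\ edge_set [set e in E ++ E'].
  apply: links_can_win_first u _ lE lE'; last by move=> c; rewrite all_st.
    by rewrite card_ord /n; lia.
  by rewrite sd.
exists [set e in E ++ E']; split=> //.
by rewrite cardsE (leq_trans (card_size _)) // size_cat leq_add.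
Qed.

(** Descent on the number of edges: by excluded middle, either a winning graph with fewer edges
    exists or the present one is minimal. *)
Lemma is_mhat_le n m (E : {set {set 'I_n}}) :
    edge_set E -> maker_can_win_first E -> #|E| <= m ->
  exists2 k, is_mhat n k & k <= m.
Proof.
move: {2}#|E| (erefl #|E|) => k; elim/ltn_ind: k E => k IH E Ek eE wE Em.
have [[E' [eE' wE' lt]]|no] := classic (exists E' : {set {set 'I_n}},
    [/\ edge_set E', maker_can_win_first E' & #|E'| < k]).
  by apply: (IH _ lt E') => //; apply: leq_trans (ltnW lt) _; rewrite -Ek.
exists k; last by rewrite -Ek.
split; first by exists E.
by move=> E' eE' wE'; rewrite leqNgt; apply/negP => lt; apply: no; exists E'.
Qed.

Theorem theorem4 (n : nat) (hn : 336 <= n) :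
  exists2 m : nat, is_mhat n m & m <= 4 * n.
Proof.
(* 18 * b = 4 * (2 * n) = n modulo 7. *)
pose b := (2 * n) %% 7; pose a := (n - 18 * b) %/ 7 - 2.
(* Here n - 18 * b = 7 * (a + 2), with one 7 for the first link and [a.+1] sevens in the second. As
   b <= 6, the hypothesis on n keeps both subtractions from truncating. *)
have nE : n = 6.+1 + (7 * a.+1 + 18 * b) by rewrite /a /b; lia.
pose d' := 7 * a + 5 + 18 * b.
have dE : 7 * a.+1 + 18 * b = d'.+2 by rewrite /d'; lia.
have := linkable_7_18 a b; rewrite dE => l'.
have [E [eE wE cE]] := linkable_can_win_first linkable_7 l'.
have -> : n = 6.+1 + d'.+2 by rewrite nE dE.
apply: (is_mhat_le eE wE); apply: leq_trans cE _.
by rewrite mulnDr leq_add2r.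
Qed.
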